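(* For any permutation $\pi$ and any entangling $E$ of $\pi$, there exists $S \in \{+,-\}^{|\Lambda(E)|}$ for which the signed partition $P = (\Lambda(E), S)$ is unique. In particular, $d(\pi) \leq u(\pi)$ for any permutation $\pi$.
   Context: Let $\pi=(\pi_1,\dots,\pi_k)$ be a permutation of $[k]$. A consecutive subsequence is $\pi[i,j]=(\pi_i,\dots,\pi_j)$, $1\le i\le j\le k$; for such $\sigma$, $\min\sigma,\max\sigma$ denote its minimum and maximum values. Shadowed: let $\sigma=\pi[x,y]$ and $\sigma'=\pi[x',y']$ be disjoint consecutive subsequences of length at least two, and let $x'\le m,M\le y'$ be the indices with $\pi_m=\min\pi[x',y']$, $\pi_M=\max\pi[x',y']$. $\sigma'$ is shadowed with respect to $\sigma$ if one of: (i) $x'>y$, $m<M$, $\pi_{x'-1}>\pi_M$; (ii) $x'>y$, $m>M$, $\pi_{x'-1}<\pi_m$; (iii) $y'<x$, $m<M$, $\pi_{y'+1}<\pi_m$; (iv) $y'<x$, $m>M$, $\pi_{y'+1}>\pi_M$. Entangling: a collection $E=(\sigma_1,\dots,\sigma_t)$ of pairwise disjoint consecutive subsequences, $\sigma_i=\pi[a_i,b_i]$, such that (1) for each $2\le j\le t$: either $a_j>b_1$ and $\min_{i<j}\min\sigma_i<\pi_{a_j}<\max_{i<j}\max\sigma_i$, or $b_j<a_1$ and $\min_{i<j}\min\sigma_i<\pi_{b_j}<\max_{i<j}\max\sigma_i$; (2) for each $2\le j\le t$, $\sigma_j$ is not shadowed with respect to $\sigma_1$; (3) for every $1\le \ell\le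 k$ there is $\sigma\in E$ with $\min\sigma\le\ell\le\max\sigma$. $\Lambda(E)$ is the partition of $\pi$ into consecutive parts in which $\sigma_1,\dots,\sigma_t$ are parts and every element of $\pi$ not in $\bigcup_i\sigma_i$ is its own part; $d(E)=|\Lambda(E)|=k-\sum_{\sigma\in E}(|\sigma|-1)$, and $d(\pi)=\max_E d(E)$ over all entanglings. Signed partitions and uniqueness: a partition $\Lambda=(\sigma_1,\dots,\sigma_\ell)$ of $\pi$ splits it into consecutive parts $\sigma_i=\pi[r_{i-1}+1,r_i]$ ($r_0=0$, $r_\ell=k$, $k_i=r_i-r_{i-1}$). A signed partition $P=(\Lambda,S)$ has $S=(s_1,\dots,s_\ell)\in\{+,-\}^\ell$ with, for each $\sigma_i$ of length $>1$, $s_i=-$ if $\min\sigma_i$ appears before $\max\sigma_i$ in $\pi$ and $s_i=+$ otherwise. Define $f_P\colon[k^2]\to\mathbb{R}$ by $f_P(r_{i-1}k+mk_i+j)=m+\pi_{r_{i-1}+j}/(2k)$ if $s_i=+$ and $=(k-1-m)+\pi_{r_{i-1}+j}/(2k)$ if $s_i=-$ ($1\le i\le \ell$, $1\le j\le k_i$, $0\le m\le k-1$). A $\pi$-copy in a sequence $g$ is a set of indices $i_1<\dots<i_k$ with $g(i_a)<g(i_b)$ iff $\pi_a<\pi_b$. For each $m$, the entries $x$ with $m<f_P(x)<m+1$ form a trivial $\pi$-copy; $P$ is unique if $f_P$ has no non-trivial $\pi$-copy. $u(\pi)$ is the maximum size of a unique signed partition. *)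

(* Defs.v *)
From mathcomp Require Import all_boot all_order all_algebra all_fingroup.
From mathcomp Require Import boolp reals zify.

Set Implicit Arguments.
Unset Strict Implicit.
Unset Printing Implicit Defensive.

Import Order.TTheory GRing.Theory Num.Theory.

(* A permutation of [k] is an element of 'S_k, but positions and values are
   numbered from 1: [pval pi i] is pi_i in [k] for i in [k].  Its values at
   other positions are irrelevant. *)
Definition pval (k : nat) (pi : 'S_k) (i : nat) : nat :=
  if insub i.-1 is Some j then (pi j).+1 else 0.

(* The consecutive subsequence pi[a,b] is represented by the pair (a, b). *)
Definition segment : Type := (nat * nat)%type.

Definition is_segment (k : nat) (s : segment) : bool :=
  [&& 1 <= s.1, s.1 <= s.2 & s.2 <= k].

Definition seg_len (s : segment) : nat := s.2.+1 - s.1.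

Definition in_seg (i : nat) (s : segment) : bool := s.1 <= i <= s.2.

Definition seg_disjoint (s t : segment) : bool := (s.2 < t.1) || (t.2 < s.1).

Section Permutation.
Variables (k : nat) (pi : 'S_k).

Definition seg_vals (s : segment) : seq nat :=
  [seq pval pi i | i <- iota s.1 (seg_len s)].

Definition seg_min (s : segment) : nat :=
  \big[minn/pval pi s.1]_(v <- seg_vals s) v.

Definition seg_max (s : segment) : nat := \max_(v <- seg_vals s) v.

Definition argmin (s : segment) : nat :=
  s.1 + index (seg_min s) (seg_vals s).

Definition argmax (s : segment) : nat :=
  s.1 + index (seg_max s) (seg_vals s).

(* [shadowed s s']: s' is shadowed with respect to s. *)
Definition shadowed (s s' : segment) : Prop :=
  let m := argmin s' in
  let M := argmax s' in
  [/\ seg_disjoint s s', 2 <= seg_len s, 2 <= seg_len s' &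
      [\/ [/\ s'.1 > s.2, m < M & pval pi s'.1.-1 > pval pi M],
          [/\ s'.1 > s.2, m > M & pval pi s'.1.-1 < pval pi m],
          [/\ s'.2 < s.1, m < M & pval pi s'.2.+1 < pval pi m] |
          [/\ s'.2 < s.1, m > M & pval pi s'.2.+1 > pval pi M]]].

Definition fam_min (E : seq segment) : nat :=
  \big[minn/seg_min (head (0, 0) E)]_(s <- E) seg_min s.

Definition fam_max (E : seq segment) : nat := \max_(s <- E) seg_max s.

(* List indices start at 0, so sigma_j is at index j.-1, and
   [take j E] consists of the segments that precede index j. *)
Definition entangling (E : seq segment) : Prop :=
  let s1 := head (0, 0) E in
  [/\ all (is_segment k) E,
      pairwise seg_disjoint E,
      forall j, 1 <= j < size E ->
        let s := nth (0, 0) E j in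
        let lo := fam_min (take j E) in
        let hi := fam_max (take j E) in
        (s.1 > s1.2 /\ lo < pval pi s.1 < hi) \/
        (s.2 < s1.1 /\ lo < pval pi s.2 < hi),
      forall j, 1 <= j < size E -> ~ shadowed s1 (nth (0, 0) E j) &
      forall l, 1 <= l <= k ->
        exists2 s, s \in E & seg_min s <= l <= seg_max s].

(* Parts are listed from left to right; the right endpoints are
   r_1 < ... < r_l = k, and the i-th part is (r_(i-1) + 1, r_i). *)
Definition is_partition (L : seq segment) : bool :=
  let r := unzip2 L in
  [&& path ltn 0 r, last 0 r == k & L == pairmap (fun x y => (x.+1, y)) 0 r].

Definition Lambda (E : seq segment) : seq segment :=
  sort (fun s t => s.1 <= t.1)
       (E ++ [seq (i, i) | i <- iota 1 k & ~~ has (in_seg i) E]).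

Definition dE (E : seq segment) : nat := size (Lambda E).

(* The maximum of dE over all entanglings; dE E <= k by [dE_le]. *)
Definition d : nat :=
  \max_(n < k.+1 | `[< exists2 E, entangling E & dE E = n >]) n.

(* Signs are booleans: true is + and false is -. *)
Definition signed_partition (L : seq segment) (S : seq bool) : Prop :=
  [/\ is_partition L, size S = size L &
      forall i, i < size L ->
        let s := nth (0, 0) L i in
        1 < seg_len s -> nth true S i = ~~ (argmin s < argmax s)].

Section Reals.
Variable R : realType.
Local Open Scope ring_scope.

(* f_P as a function on {1, ..., k^2}.  The i-th part (a, b) occupies the
   indices in ((a-1)k, bk], i.e. those x with (x-1) %/ k + 1 in [a, b]; within
   them x = (a-1)k + m k_i + j is decomposed by Euclidean division by k_i.
   See [fPE] for the defining equation. *)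
Definition fP (L : seq segment) (S : seq bool) (x : nat) : R :=
  let i := find (in_seg (x.-1 %/ k).+1) L in
  let s := nth (0%N, 0%N) L i in
  let r := s.1.-1 in
  let ki := seg_len s in
  let y := (x.-1 - r * k)%N in
  let m := (y %/ ki)%N in
  let j := (y %% ki).+1 in
  (if nth true S i then m else (k - 1 - m)%N)%:R
  + (pval pi (r + j))%:R / (2 * k)%:R.

(* A pi-copy in g(1), ..., g(n) is given by the increasing list c of its
   indices. *)
Definition copy (n : nat) (g : nat -> R) (c : seq nat) : Prop :=
  [/\ size c = k, sorted ltn c, all (fun x => 1 <= x <= n)%N c &
      forall a b, (1 <= a <= k)%N -> (1 <= b <= k)%N ->
        (g (nth 0%N c a.-1) < g (nth 0%N c b.-1)) = (pval pi a < pval pi b)%N].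

Definition trivial_copy (n : nat) (g : nat -> R) (c : seq nat) : Prop :=
  exists2 m, (m < k)%N &
    forall x, (x \in c) = (1 <= x <= n)%N && (m%:R < g x < m.+1%:R).

Definition unique (L : seq segment) (S : seq bool) : Prop :=
  forall c, copy (k ^ 2) (fP L S) c -> trivial_copy (k ^ 2) (fP L S) c.

(* The maximum of size L over all unique signed partitions (L, S); size L <= k
   by [partition_size_le]. *)
Definition u : nat :=
  (\max_(n < k.+1 | `[< exists L S,
      [/\ signed_partition L S, unique L S & size L = n] >]) n)%N.

End Reals.

Lemma path_ltn_size x (r : seq nat) : path ltn x r -> x + size r <= last x r.
Proof.
elim: r x => [|y r IH] x /=; first by rewrite addn0.
move=> /andP[xy /IH]; apply: leq_trans.
by rewrite addnS -addSn leq_add2r.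
Qed.

Lemma partition_size_le L : is_partition L -> size L <= k.
Proof.
case/and3P=> /path_ltn_size + /eqP lastr _.
by rewrite lastr add0n size_map.
Qed.

Lemma count_in_seg s : is_segment k s ->
  count (in_seg^~ s) (iota 1 k) = seg_len s.
Proof.
case: s => a b /and3P[/= a1 ab bk].
have -> : iota 1 k = iota 1 a.-1 ++ iota a (b.+1 - a) ++ iota b.+1 (k - b).
  have -> : k = a.-1 + ((b.+1 - a) + (k - b)) by lia.
  rewrite iotaD iotaD; congr (_ ++ (iota _ _ ++ iota _ _)); lia.
rewrite !count_cat.
rewrite (@eq_in_count _ _ pred0 (iota 1 _)) ?count_pred0; last first.
  move=> i; rewrite mem_iota add1n prednK // => /andP[_ ia].
  by rewrite /in_seg /= leqNgt ia.
rewrite (@eq_in_count _ _ predT (iota a _)) ?count_predT; last first.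
  by move=> i; rewrite mem_iota /in_seg /=; lia.
rewrite (@eq_in_count _ _ pred0 (iota b.+1 _)) ?count_pred0; last first.
  move=> i; rewrite mem_iota => /andP[bi _].
  by rewrite /in_seg /= [i <= b]leqNgt bi andbF.
by rewrite size_iota add0n addn0.
Qed.

Lemma count_covered E : all (is_segment k) E -> pairwise seg_disjoint E ->
  count (fun i => has (in_seg i) E) (iota 1 k) = \sum_(s <- E) seg_len s.
Proof.
elim: E => [|s E IH] /=; first by rewrite big_nil count_pred0.
move=> /andP[sk Ek] /andP[/allP sE dE0]; rewrite big_cons -IH // -count_in_seg //.
rewrite -count_predUI.
rewrite -[LHS]addn0; congr (_ + _); apply/esym/eqP; rewrite -leqn0 leqNgt -has_count.
apply/hasPn => i _ /=; apply/negP => /andP[/andP[ai ib] /hasP[t tE /andP[ci id']]].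
case/orP: (sE _ tE) => lt.
  by move: (leq_trans (leq_ltn_trans ib lt) ci); rewrite ltnn.
by move: (leq_trans (leq_ltn_trans id' lt) ai); rewrite ltnn.
Qed.

Lemma dE_formula E : entangling E ->
  dE E + \sum_(s <- E) (seg_len s - 1) = k.
Proof.
case=> Ek Ed _ _ _.
rewrite /dE size_sort size_cat size_map size_filter.
have := count_predC (fun i => has (in_seg i) E) (iota 1 k).
rewrite size_iota count_covered // => kE; rewrite -[RHS]kE.
rewrite addnAC; congr (_ + _).
rewrite -sum1_size -big_split /=; apply: eq_big_seq => s /(allP Ek).
by case/and3P=> _ ab _; rewrite subnKC // /seg_len subn_gt0 ltnS.
Qed.

Lemma dE_le E : entangling E -> dE E <= k.
Proof. by move/dE_formula; lia. Qed.

Lemma is_partition_nth L i : is_partition L -> i < size L ->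
  let s := nth (0, 0) L i in
  [/\ s.1 = (nth 0 (0 :: unzip2 L) i).+1, s.1 <= s.2 & s.2 <= k].
Proof.
case/and3P=> pL /eqP lL /eqP eL iL /=.
have ir : i < size (unzip2 L) by rewrite size_map.
have e2 : (nth (0, 0) L i).2 = nth 0 (unzip2 L) i by rewrite (nth_map (0, 0)).
have e1 : (nth (0, 0) L i).1 = (nth 0 (0 :: unzip2 L) i).+1.
  by rewrite {1}eL (nth_pairmap 0).
split=> //; first by rewrite e1 e2; move/(pathP 0): pL => /(_ i ir).
have sr : sorted ltn (0 :: unzip2 L) by [].
rewrite e2 -lL (last_nth 0).
have := sorted_leq_nth leq_trans leqnn 0
  (sub_sorted (fun x y => @ltnW x y) sr).
by move/(_ i.+1 (size (unzip2 L))); apply; rewrite ?inE //=.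
Qed.

Lemma is_partition_find L i c : is_partition L -> i < size L ->
  in_seg c (nth (0, 0) L i) -> find (in_seg c) L = i.
Proof.
move=> pL iL ci.
have hasc : has (in_seg c) L by apply/hasP; exists (nth (0, 0) L i); rewrite ?mem_nth.
have fi : find (in_seg c) L <= i by rewrite leqNgt; apply/negP => /(before_find (0, 0)); rewrite ci.
apply/eqP; rewrite eqn_leq fi leqNgt; apply/negP => lt.
have := nth_find (0, 0) hasc; set h := find _ _ in fi lt *.
case/andP=> _ ch; case/andP: ci => ic _.
have [e1 _ _] := is_partition_nth pL iL.
have hL : h < size L by rewrite -has_find.
have sr : sorted ltn (0 :: unzip2 L) by case/and3P: pL.
have := sorted_leq_nth leq_trans leqnn 0
  (sub_sorted (fun x y => @ltnW x y) sr).
move/(_ h.+1 i); rewrite !inE /= size_map => /(_ _ _ lt).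
rewrite ltnS hL ltnS (ltnW iL) => /(_ isT isT) le.
have e2 : (nth (0, 0) L h).2 = nth 0 (unzip2 L) h by rewrite (nth_map (0, 0)).
by move: (leq_trans ic ch); rewrite e1 e2 ltnNge le.
Qed.

Lemma fPE (R : realType) L S i m j : is_partition L -> i < size L ->
  let s := nth (0, 0) L i in
  let r := s.1.-1 in
  let ki := seg_len s in
  m < k -> 1 <= j <= ki ->
  (fP R L S (r * k + m * ki + j) =
   (if nth true S i then m else (k - 1 - m)%N)%:R
   + (pval pi (r + j))%:R / (2 * k)%:R)%R.
Proof.
move=> pL iL s r ki mk /andP[j1 jk].
have [e1 ab bk] := is_partition_nth pL iL; rewrite -/s in e1 ab bk.
have k0 : 0 < k by apply: leq_ltn_trans mk.
have rE : r.+1 = s.1 by rewrite /r e1.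
have xE : (r * k + m * ki + j).-1 = r * k + (m * ki + j.-1).
  by rewrite -addnA -{1}(prednK j1) !addnS.
have lt : m * ki + j.-1 < ki * k.
  have : m.+1 * ki <= k * ki by rewrite leq_mul2r mk orbT.
  rewrite mulSn [k * ki]mulnC; lia.
rewrite /fP xE.
have -> : find (in_seg ((r * k + (m * ki + j.-1)) %/ k).+1) L = i.
  apply: is_partition_find => //; rewrite -/s /in_seg divnMDl // -rE ltnS leq_addr /=.
  have := lt; rewrite -ltn_divLR // => lt'.
  have -> : s.2 = r + ki by rewrite /ki /seg_len; lia.
  by rewrite ltn_add2l.
rewrite -/s -/r -/ki addKn.
have ki0 : 0 < ki by apply: leq_trans jk.
have jlt : j.-1 < ki by rewrite prednK.
by rewrite divnMDl // divn_small // addn0 modnMDl modn_small // prednK.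
Qed.

End Permutation.

(* Main.v *)
Require Import Defs.
From mathcomp Require Import all_boot all_order all_algebra all_fingroup.
From mathcomp Require Import boolp reals zify.

Set Implicit Arguments.
Unset Strict Implicit.
Unset Printing Implicit Defensive.

Import Order.TTheory GRing.Theory Num.Theory.
Import Defs.

(** Parts of length one are signed so that a part to the right (left) of sigma_1,
    say pi[x,y], cannot have all the entries of a pi-copy at positions x-1,...,y
    (x,...,y+1) in its block: by the sign, and by non-shadowing if x < y, they
    would lie on one level, which has only y-x+1 entries in that block.  Going from
    the ends of pi towards sigma_1, this traps the entries of the copy at the
    positions of sigma_1 in the block of sigma_1.  There the minimum and the maximum
    are forced onto a common level m, so these entries are those of the trivial
    copy of level m.  The entries of the copy whose values lie between two entries
    of that trivial copy also belong to it; in particular so does the near end of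
    sigma_2, which traps sigma_2 in its own block, and so on along the entangling.
    Since the value ranges cover [k], the copy is trivial. *)

(** * Strictly increasing maps and extrema of lists of naturals *)

Lemma strict_incr_gap (f : nat -> nat) a b :
  (forall p, a <= p < b -> f p < f p.+1) ->
  forall p q, a <= p -> p <= q -> q <= b -> f p + (q - p) <= f q.
Proof.
move=> fS p q ap; elim: q => [|q IH] pq qb.
  by move: pq; rewrite leqn0 => /eqP ->; lia.
case: (eqVneq p q.+1) => [->|pNq]; first by lia.
by have := fS q; lia.
Qed.

(** Each step gains at least 1 and the room from [a] to [b] is only [b - a], so no step can gain
    more. The rigidity arguments below, along positions and along values, both rest on this. *)
Lemma strict_incr_fixed (f : nat -> nat) a b :
  (forall p, a <= p < b -> f p < f p.+1) -> a <= f a -> f b <= b ->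
  forall p, a <= p <= b -> f p = p.
Proof.
move=> /strict_incr_gap gap fa fb p /andP[ap pb].
have := gap a p; have := gap p b; lia.
Qed.

Lemma bigmin_mem x0 (s : seq nat) :
  x0 \in s -> \big[minn/x0]_(v <- s) v \in s.
Proof.
(* The default [x0] stays fixed while the list shrinks, so the induction must allow the value [x0]
   even when [t] does not contain it. *)
have key t : \big[minn/x0]_(v <- t) v \in x0 :: t.
  elim: t => [|v t IH]; rewrite ?big_nil ?big_cons ?inE ?eqxx //.
  move: IH; rewrite inE /minn; case: ifP => _; first by rewrite eqxx orbT.
  by case/orP=> ->; rewrite ?orbT.
by move=> x0s; move: (key s); rewrite inE => /orP[/eqP ->|].
Qed.

Lemma bigmin_le x0 (s : seq nat) x :
  x \in s -> \big[minn/x0]_(v <- s) v <= x.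
Proof.
elim: s => // v s IH; rewrite inE big_cons geq_min => /orP[/eqP ->|/IH ->].
  by rewrite leqnn.
by rewrite orbT.
Qed.

Lemma bigmax_mem (s : seq nat) : s != [::] -> \max_(v <- s) v \in s.
Proof.
elim: s => // v [|w s] IH _; first by rewrite big_seq1 mem_head.
rewrite big_cons /maxn inE; case: ifP => _; last by rewrite eqxx.
by rewrite IH ?orbT.
Qed.

Lemma bigmax_ge (s : seq nat) x : x \in s -> x <= \max_(v <- s) v.
Proof.
elim: s => // v s IH; rewrite inE big_cons leq_max => /orP[/eqP ->|/IH ->].
  by rewrite leqnn.
by rewrite orbT.
Qed.

(** * Values of a permutation and extrema of segments and families *)

Section Values.
Variables (k : nat) (pi : 'S_k).

Lemma pval_ord (i : 'I_k) : pval pi i.+1 = (pi i).+1.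
Proof. by rewrite /pval insubT //= => ik; congr (pi _).+1; apply: val_inj. Qed.

Lemma pval_bounds p : 1 <= p <= k -> 1 <= pval pi p <= k.
Proof.
case: p => // p pk; have /= -> := pval_ord (Ordinal pk).
by rewrite /= ltn_ord.
Qed.

Lemma pval_inj p q : 1 <= p <= k -> 1 <= q <= k -> pval pi p = pval pi q -> p = q.
Proof.
case: p => // p pk; case: q => // q qk.
have /= -> := pval_ord (Ordinal pk); have /= -> := pval_ord (Ordinal qk).
by case=> /val_inj/perm_inj [->].
Qed.

Lemma pvalVK v : 1 <= v <= k -> pval pi (pval (pi^-1)%g v) = v.
Proof.
case: v => // v vk; rewrite {2}/pval insubT /=.
by rewrite pval_ord permKV.
Qed.

Variables (s : segment) (sk : is_segment k s).

Lemma mem_seg_vals p : in_seg p s -> pval pi p \in seg_vals pi s.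
Proof.
move=> ps; apply: map_f; rewrite mem_iota; move: ps sk.
rewrite /in_seg /is_segment /seg_len; lia.
Qed.

Lemma seg_vals_index v : v \in seg_vals pi s ->
  in_seg (s.1 + index v (seg_vals pi s)) s /\
  pval pi (s.1 + index v (seg_vals pi s)) = v.
Proof.
move=> vs; have := vs; rewrite -index_mem size_map size_iota => lt.
split.
  by move: lt sk; rewrite /in_seg /is_segment /seg_len; lia.
by rewrite -[RHS](nth_index 0 vs) (nth_map 0) ?size_iota // nth_iota.
Qed.

Lemma in_seg_left : in_seg s.1 s.
Proof. by move: sk; rewrite /in_seg /is_segment; lia. Qed.

Lemma argminP : in_seg (argmin pi s) s /\ pval pi (argmin pi s) = seg_min pi s.
Proof. by apply: seg_vals_index; apply/bigmin_mem/mem_seg_vals/in_seg_left. Qed.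

Lemma argmaxP : in_seg (argmax pi s) s /\ pval pi (argmax pi s) = seg_max pi s.
Proof.
apply/seg_vals_index/bigmax_mem; apply/eqP => e.
by have := mem_seg_vals in_seg_left; rewrite e.
Qed.

Lemma seg_min_max p : in_seg p s -> seg_min pi s <= pval pi p <= seg_max pi s.
Proof. by move/mem_seg_vals => ps; rewrite bigmin_le // bigmax_ge. Qed.

Lemma argmin_lt_argmax : 1 < seg_len s ->
  argmin pi s != argmax pi s /\ pval pi (argmin pi s) < pval pi (argmax pi s).
Proof.
move=> len; have [ms mE] := argminP; have [Ms ME] := argmaxP.
have sb : in_seg s.2 s by move: sk; rewrite /in_seg /is_segment; lia.
suff lt : seg_min pi s < seg_max pi s.
  by rewrite mE ME lt; split=> //; apply/eqP => e; move: lt; rewrite -mE -ME e ltnn.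
have := seg_min_max in_seg_left; have := seg_min_max sb.
have : pval pi s.1 != pval pi s.2.
  apply/eqP => /pval_inj e; move: len sk; rewrite /seg_len /is_segment => len sk'.
  by have := e; lia.
by lia.
Qed.

End Values.

Lemma fam_min_mem k (pi : 'S_k) E : E != [::] ->
  exists2 s, s \in E & fam_min pi E = seg_min pi s.
Proof.
case: E => // s0 E _; rewrite /fam_min /=.
have : \big[minn/seg_min pi s0]_(s <- s0 :: E) seg_min pi s
    \in map (seg_min pi) (s0 :: E).
  by rewrite -(big_map (seg_min pi) xpredT id) bigmin_mem // mem_head.
by case/mapP => s ? ?; exists s.
Qed.

Lemma fam_max_mem k (pi : 'S_k) E : E != [::] ->
  exists2 s, s \in E & fam_max pi E = seg_max pi s.
Proof.
move=> E0; have : fam_max pi E \in map (seg_max pi) E.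
  rewrite /fam_max -(big_map (seg_max pi) xpredT id) bigmax_mem //.
  by case: E E0.
by case/mapP => s ? ?; exists s.
Qed.

Lemma seg_disjointC : symmetric seg_disjoint.
Proof. by move=> s t; rewrite /seg_disjoint orbC. Qed.

(** * [Lambda k E] is a partition *)

Lemma is_partition_sorted k L :
  sorted (fun s t : segment => s.1 <= t.1) L -> uniq L -> all (is_segment k) L ->
  {in L &, forall s t, s != t -> seg_disjoint s t} ->
  (forall p, 1 <= p <= k -> exists2 s, s \in L & in_seg p s) ->
  is_partition k L.
Proof.
move=> sL uL aL dL cL.
(* The start 0 becomes an arbitrary [r], with [L'] tiling the positions above [r]; removing the head
   moves [r] to the right end of that head. *)
suff key r L' : r <= k -> sorted (fun s t : segment => s.1 <= t.1) L' -> uniq L' ->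
  (forall s, s \in L' -> r < s.1 /\ is_segment k s) ->
  {in L' &, forall s t, s != t -> seg_disjoint s t} ->
  (forall p, r < p <= k -> exists2 s, s \in L' & in_seg p s) ->
  [&& path ltn r (unzip2 L'), last r (unzip2 L') == k &
      L' == pairmap (fun x y => (x.+1, y)) r (unzip2 L')].
  apply: key => // s sL'; move/allP: aL => /(_ _ sL') sk; split=> //.
  by case/and3P: sk.
elim: L' r => [|s L' IH] r rk /= sL' uL' rL' dL' cL'.
  rewrite andbT; case: (eqVneq r k) => // rNk.
  by case: (cL' r.+1) => //; lia.
(* The part that covers [r.+1] starts there, and no later part starts before the head does, so the
   head starts there too. *)
have sE : s.1 = r.+1.
  have [|t tL /andP[t1 _]] := cL' r.+1.
    have [] := rL' s (mem_head _ _); rewrite /is_segment; lia.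
  have [rt _] := rL' t tL; have [rs _] := rL' s (mem_head _ _).
  move: tL; rewrite inE => /orP[/eqP ts|tL]; first by move: rt t1; rewrite ts; lia.
  have tr : transitive (fun s t : segment => s.1 <= t.1) by move=> ? ? ?; apply: leq_trans.
  by have /allP/(_ t tL) := order_path_min tr sL'; lia.
have [rs sk] := rL' s (mem_head _ _); case/and3P: sk => s1 s12 s2.
case/andP: uL' => sN uL'.
have sub : {subset L' <= s :: L'} by move=> t tL; rewrite inE tL orbT.
have rL'' t : t \in L' -> s.2 < t.1 /\ is_segment k t.
  move=> tL; have [rt tk] := rL' t (sub _ tL).
  split=> //; have /= := dL' s t (mem_head _ _) (sub _ tL).
  case: eqVneq => [st|_ /(_ isT)]; first by rewrite st tL in sN.
  by move: tk; rewrite /is_segment /seg_disjoint; lia.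
have dL'' : {in L' &, forall s t, s != t -> seg_disjoint s t}.
  by move=> t t' tL t'L; apply: dL'; apply: sub.
have cL'' p : s.2 < p <= k -> exists2 t, t \in L' & in_seg p t.
  move=> pk; have [|t] := cL' p; first by lia.
  rewrite inE => /orP[/eqP ->|tL pt]; last by exists t.
  by rewrite /in_seg; lia.
have /and3P[-> -> /eqP <-] := IH s.2 s2 (path_sorted sL') uL' rL'' dL'' cL''.
rewrite !andbT eqseq_cons eqxx andbT.
by rewrite -sE; move: s12 rs; case: (s) => a b /=; rewrite eqxx andbT; lia.
Qed.

Section LambdaPartition.
Variables (k : nat) (E : seq segment).

Lemma mem_Lambda s : (s \in Lambda k E) =
  (s \in E) || [&& s.1 == s.2, 1 <= s.1 <= k & ~~ has (in_seg s.1) E].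
Proof.
rewrite mem_sort mem_cat; congr (_ || _).
apply/mapP/idP => [[i]|/and3P[/eqP e sk nE]].
  by rewrite mem_filter mem_iota => /andP[nE ik] -> /=; rewrite eqxx nE; lia.
exists s.1; last by rewrite {2}e; case: (s).
by rewrite mem_filter nE mem_iota; lia.
Qed.

Lemma Lambda_cover p : 1 <= p <= k -> exists2 s, s \in Lambda k E & in_seg p s.
Proof.
move=> pk; case: (boolP (has (in_seg p) E)) => [/hasP[s sE ps]|nE].
  by exists s; rewrite // mem_Lambda sE.
exists (p, p); last by rewrite /in_seg leqnn.
by rewrite mem_Lambda /= eqxx nE pk orbT.
Qed.

Hypotheses (Ek : all (is_segment k) E) (Ed : pairwise seg_disjoint E).

Lemma entangled_disjoint : {in E &, forall s t, s != t -> seg_disjoint s t}.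
Proof.
move=> s t sE tE st; move/(pairwiseP (0, 0)): Ed => Ed'.
have := Ed' (index s E) (index t E); have := Ed' (index t E) (index s E).
rewrite !inE !index_mem !nth_index // sE tE [seg_disjoint t s]seg_disjointC.
move=> /(_ isT isT) H1 /(_ isT isT) H2.
case: (ltngtP (index s E) (index t E)) => [/H2|/H1|e] //.
by case/negP: st; rewrite -(nth_index (0,0) sE) e nth_index.
Qed.

Lemma Lambda_partition : is_partition k (Lambda k E).
Proof.
have tot : total (fun s t : segment => s.1 <= t.1) by move=> s t; apply: leq_total.
apply: is_partition_sorted; first exact: sort_sorted.
- rewrite sort_uniq cat_uniq; apply/and3P; split.
  + move: Ek Ed; elim: (E) => //= s E' IH /andP[sk Ek'] /andP[/allP sE' Ed'].
    rewrite IH // andbT; apply/negP => /sE'; move: sk.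
    by rewrite /is_segment /seg_disjoint; lia.
  + apply/hasPn => s /mapP[i]; rewrite mem_filter => /andP[/hasPn nE _] ->.
    by apply/negP => /nE; rewrite /in_seg /= leqnn.
  + rewrite map_inj_uniq; last by move=> i j [].
    by rewrite filter_uniq // iota_uniq.
- apply/allP => s; rewrite mem_Lambda => /orP[/(allP Ek)//|/and3P[/eqP es sk _]].
  by rewrite /is_segment -es leqnn; move: sk => /andP[-> ->].
- move=> [a b] [a' b']; rewrite !mem_Lambda /=.
  move=> /orP[sE|/and3P[/eqP es sk /hasPn nE]].
    move=> /orP[tE|/and3P[/eqP et tk /hasPn nE]]; first exact: entangled_disjoint.
    by have := nE _ sE; rewrite /in_seg /seg_disjoint /= -et; lia.
  move=> /orP[tE|/and3P[/eqP et tk _]].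
    by have := nE _ tE; rewrite /in_seg /seg_disjoint /= -es; lia.
  by rewrite -es -et xpair_eqE andbb /seg_disjoint /=; lia.
- exact: Lambda_cover.
Qed.

End LambdaPartition.

(** * Signs of the parts, and rigidity of a copy inside one block or one range of values *)

Definition part (L : seq segment) (p : nat) : segment :=
  nth (0, 0) L (find (in_seg p) L).

Lemma part_eq k L s p : is_partition k L -> s \in L -> in_seg p s -> part L p = s.
Proof.
move=> pL sL ps; rewrite /part (@is_partition_find k L (index s L)) ?nth_index //.
by rewrite index_mem.
Qed.

(* The sign of a part of length one is the one that keeps the entries of a copy
   at positions [p] and [p - 1] (to the right of [s1]), respectively [p] and
   [p + 1] (to its left), from both lying in the block of [(p, p)]. *)
Definition part_sign k (pi : 'S_k) (s1 s : segment) : bool :=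
  if 1 < seg_len s then ~~ (argmin pi s < argmax pi s)
  else if s1.2 < s.1 then ~~ (pval pi s.1.-1 < pval pi s.1)
  else ~~ (pval pi s.1 < pval pi s.1.+1).

(* [col p] and [lev p] are the position in [pi] and the level [m] of the entry of
   f_P that serves as the [p]-th element of the copy. *)
Section CopyCoordinates.
Variables (k : nat) (pi : 'S_k) (E : seq segment).
Hypothesis entE : entangling pi E.
Local Notation L := (Lambda k E).
Local Notation s1 := (head (0, 0) E).
Variables (lev col : nat -> nat).
Hypothesis col_bounds : forall p, 1 <= p <= k -> 1 <= col p <= k.
Hypothesis col_block : forall p q, 1 <= p -> p < q -> q <= k ->
  (part L (col p)).1 <= col q.
Hypothesis lev_mono : forall p q, 1 <= p -> p < q -> q <= k ->
  part L (col p) = part L (col q) ->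
  if part_sign pi s1 (part L (col p)) then lev p <= lev q else lev q <= lev p.
Hypothesis col_incr : forall p q, 1 <= p -> p < q -> q <= k ->
  part L (col p) = part L (col q) -> lev p = lev q -> col p < col q.
Hypothesis lev_order : forall p q, 1 <= p <= k -> 1 <= q <= k ->
  pval pi p < pval pi q ->
  lev p <= lev q /\ (lev p = lev q -> pval pi (col p) < pval pi (col q)).

Let Ek : all (is_segment k) E. Proof. by case: entE. Qed.
Let Ed : pairwise seg_disjoint E. Proof. by case: entE. Qed.
Let Lpart : is_partition k L. Proof. exact: Lambda_partition. Qed.

Lemma Lambda_seg (s : segment) : s \in L -> [/\ 1 <= s.1, s.1 <= s.2 & s.2 <= k].
Proof.
rewrite mem_Lambda => /orP[sE|]; first by apply/and3P; apply: (allP Ek).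
by case: s => a b /= /and3P[/eqP <- /andP[? ?] _].
Qed.

Lemma mem_E_Lambda (s : segment) : s \in E -> s \in L.
Proof. by rewrite mem_Lambda => ->. Qed.

Lemma long_mem_E (s : segment) : s \in L -> 1 < seg_len s -> s \in E.
Proof.
rewrite mem_Lambda => /orP[//|]; case: s => a b /= /and3P[/eqP <- _ _].
by rewrite /seg_len /=; lia.
Qed.

Lemma partP p : 1 <= p <= k -> part L p \in L /\ in_seg p (part L p).
Proof. by case/(Lambda_cover E) => s sL ps; rewrite (part_eq Lpart sL ps). Qed.

Lemma level_le p q : 1 <= p <= k -> 1 <= q <= k -> pval pi p <= pval pi q ->
  lev p <= lev q.
Proof.
move=> pk qk; rewrite leq_eqVlt => /orP[/eqP/(pval_inj pk qk) -> //|].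
by case/(lev_order pk qk).
Qed.

(** The sign makes the levels move against the values of [pi] from [p] to [q], while the order of a
    copy makes them move with the values; hence they are equal. *)
Lemma level_pair (s : segment) p q : 1 <= p -> p < q -> q <= k -> s \in L ->
  in_seg (col p) s -> in_seg (col q) s ->
  part_sign pi s1 s = ~~ (pval pi p < pval pi q) -> lev p = lev q.
Proof.
move=> p1 pq qk sL ps qs sg.
have := lev_mono p1 pq qk; rewrite !(part_eq Lpart sL) // sg => /(_ erefl).
have pk : 1 <= p <= k by lia.
have qk' : 1 <= q <= k by lia.
case: (ltnP (pval pi p) (pval pi q)) => /= [/ltnW/(level_le pk qk')|/(level_le qk' pk)]; lia.
Qed.

(** The sign of a long part is fixed by the order of its minimum and maximum, so [level_pair] puts
    these two on one level. The levels of all other positions of [s] are squeezed between them, as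
    [lev] is monotone in the value. *)
Lemma block_level (s : segment) : s \in L -> (forall p, in_seg p s -> in_seg (col p) s) ->
  forall p q, in_seg p s -> in_seg q s -> lev p = lev q.
Proof.
move=> sL sB; have [a1 ab bk] := Lambda_seg sL.
have sk : is_segment k s by apply/and3P.
have [ms mE] := argminP pi sk; have [Ms ME] := argmaxP pi sk.
set m := argmin pi s in ms mE *; set M := argmax pi s in Ms ME *.
have inK p : in_seg p s -> 1 <= p <= k by rewrite /in_seg; lia.
have mM : lev m = lev M.
  case: (eqVneq m M) => [-> //|mM].
  have len : 1 < seg_len s by move: ms Ms mM; rewrite /in_seg /seg_len; lia.
  have [_ mMp] := argmin_lt_argmax pi sk len; rewrite -/m -/M in mMp.
  have sg : part_sign pi s1 s = ~~ (m < M) by rewrite /part_sign len.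
  have /andP[m1 mk] := inK _ ms; have /andP[M1 Mk] := inK _ Ms.
  case: (ltngtP m M) sg => [lt|lt|e] sg; last by rewrite e.
    by apply: (level_pair _ _ _ sL); rewrite ?sB // mMp.
  by apply/esym/(level_pair _ _ _ sL); rewrite ?sB // -leqNgt ltnW.
have all_m p : in_seg p s -> lev p = lev m.
  move=> ps; have /andP[] := seg_min_max pi sk ps; rewrite -mE -ME.
  move=> /(level_le (inK _ ms) (inK _ ps)) ? /(level_le (inK _ ps) (inK _ Ms)); lia.
by move=> p q /all_m -> /all_m ->.
Qed.

(** The blocks follow each other from left to right and so do the entries of the copy. Bounding the
    first entry from the left and the last one from the right therefore confines all of them. *)
Lemma block_between (s : segment) x y : s \in L -> 1 <= x -> x <= y -> y <= k ->
  s.1 <= col x -> col y <= s.2 -> forall p, x <= p <= y -> in_seg (col p) s.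
Proof.
move=> sL x1 xy yk sx ys.
have [a1 ab bk] := Lambda_seg sL.
have lo p : x <= p <= y -> s.1 <= col p.
  move=> pxy; case: (eqVneq x p) => [<- //|xp].
  have xk : 1 <= col x <= k by apply: col_bounds; lia.
  have : (part L (col x)).1 <= col p by apply: col_block; lia.
  suff : s.1 <= (part L (col x)).1 by lia.
  have [tL tx] := partP xk; rewrite leqNgt; apply/negP => ts.
  have sa : in_seg s.1 s by rewrite /in_seg; lia.
  have st : in_seg s.1 (part L (col x)) by move: tx; rewrite /in_seg; lia.
  by have := part_eq Lpart tL st; move: ts; rewrite (part_eq Lpart sL sa) => + e; rewrite -e; lia.
move=> p pxy; rewrite /in_seg lo //=.
case: (eqVneq p y) => [-> //|py].
rewrite leqNgt; apply/negP => sp.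
have pk : 1 <= col p <= k by apply: col_bounds; lia.
have := @col_block p y; have [tL tp] := partP pk.
move: tp; rewrite /in_seg => tp tb.
have yt : in_seg s.2 (part L (col p)) by rewrite /in_seg; lia.
have := part_eq Lpart tL yt; rewrite (@part_eq k L s) // => [e|].
  by move: tp; rewrite -e; lia.
by rewrite /in_seg; lia.
Qed.

Lemma level_incr (s : segment) x y : s \in L -> 1 <= x -> y <= k ->
  (forall p, x <= p <= y -> in_seg (col p) s) ->
  (forall p, x <= p <= y -> lev p = lev x) ->
  forall p, x <= p < y -> col p < col p.+1.
Proof.
move=> sL x1 yk sB lE p pxy.
apply: col_incr; rewrite ?lE ?(part_eq Lpart sL) //; try (apply: sB); lia.
Qed.

(** By [block_level] these entries share a level, where [col] is strictly increasing; it maps [s]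
    into [s], so it has no slack. *)
Lemma block_exact (s : segment) : s \in L -> (forall p, in_seg p s -> in_seg (col p) s) ->
  forall p, in_seg p s -> col p = p.
Proof.
move=> sL sB; have [a1 ab bk] := Lambda_seg sL.
have sa : in_seg s.1 s by rewrite /in_seg; lia.
have sb : in_seg s.2 s by rewrite /in_seg; lia.
apply: strict_incr_fixed.
- apply: (level_incr sL) => // p ps; exact: (block_level sL sB).
- by case/andP: (sB _ sa).
- by case/andP: (sB _ sb).
Qed.

(** Rigidity along values: for [v] between the two known values, monotonicity squeezes [lev (inv v)]
    to [m]. On this level [v] is sent to [pval pi (col (inv v))] by a strictly increasing map that
    fixes both ends, hence by the identity. *)
Lemma value_exact m p q r : 1 <= p <= k -> 1 <= q <= k -> 1 <= r <= k ->
  lev p = m -> col p = p -> lev r = m -> col r = r ->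
  pval pi p <= pval pi q <= pval pi r -> lev q = m /\ col q = q.
Proof.
move=> pk qk rk lp cp lr cr /andP[pq qr].
pose inv := pval (pi^-1)%g.
have invK v : 1 <= v <= k -> pval pi (inv v) = v by exact: pvalVK.
have inv_bounds v : 1 <= v <= k -> 1 <= inv v <= k by exact: pval_bounds.
have pvalK x : 1 <= x <= k -> inv (pval pi x) = x.
  move=> xk; have vk := pval_bounds pi xk.
  by apply: (@pval_inj _ pi _ _ (inv_bounds _ vk) xk); rewrite invK.
have pvk := pval_bounds pi pk; have rvk := pval_bounds pi rk.
have lE v : pval pi p <= v <= pval pi r -> lev (inv v) = m.
  move=> vpr; have vk : 1 <= v <= k by lia.
  have := level_le pk (inv_bounds _ vk); have := level_le (inv_bounds _ vk) rk.
  by rewrite invK // lp lr; lia.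
have qpr : pval pi p <= pval pi q <= pval pi r by rewrite pq.
split; first by rewrite -(pvalK q) // lE.
apply: (@pval_inj _ pi _ _ (col_bounds qk) qk).
rewrite -{1}(pvalK q) //.
apply: (@strict_incr_fixed (fun v => pval pi (col (inv v))) _ _ _ _ _ _ qpr).
- move=> v vpr; have vk : 1 <= v <= k by lia.
  have vk' : 1 <= v.+1 <= k by lia.
  have [] := lev_order (inv_bounds _ vk) (inv_bounds _ vk').
    by rewrite !invK.
  by move=> _; apply; rewrite !lE //; lia.
- by rewrite pvalK // cp.
- by rewrite pvalK // cr.
Qed.

(** * Trapping the copy, first in the block of sigma_1 and then along the entangling *)

Hypothesis k_gt1 : 1 < k.

Lemma E_neq0 : E != [::].
Proof. by case: entE => _ _ _ _ /(_ 1); case: E => // -[|s]; [lia|]. Qed.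

Lemma head_mem_E : s1 \in E.
Proof. by move: E_neq0; case: E => //= s t _; rewrite mem_head. Qed.

(** If sigma_1 had length one, no value would lie strictly between its minimum and its maximum, so
    there would be no sigma_2, and sigma_1 alone cannot cover both values 1 and 2. For [k = 1] the
    list [[:: (1, 1)]] is entangling, so [k_gt1] matters here. *)
Lemma head_long : 1 < seg_len s1.
Proof.
have s1k := allP Ek _ head_mem_E.
rewrite ltnNge; apply/negP => len1.
have eMm : seg_min pi s1 = seg_max pi s1.
  have [+ <-] := argminP pi s1k; have [+ <-] := argmaxP pi s1k.
  move: len1; rewrite /seg_len /in_seg => ? ? ?; congr (pval _ _); lia.
case: entE => _ _ e1 _ e3.
case: (ltnP 1 (size E)) => sE.
  have := e1 1; rewrite sE => /(_ isT) /=.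
  have -> : take 1 E = [:: s1] by move: E_neq0; case: E => //= s t _; rewrite take0.
  have [t] := @fam_min_mem k pi [:: s1] isT; rewrite inE => /eqP -> ->.
  have [t'] := @fam_max_mem k pi [:: s1] isT; rewrite inE => /eqP -> ->.
  by rewrite eMm; lia.
have Es1 t : t \in E -> t = s1.
  by case: E sE => [|a [|b l]] //= _; rewrite inE => /eqP.
have [|t /Es1 ->] := e3 1; first by lia.
have [|t' /Es1 ->] := e3 2; first by lia.
by rewrite eMm; lia.
Qed.

Lemma E_not_shadowed (s : segment) : s \in E -> s != s1 -> ~ shadowed pi s1 s.
Proof.
move=> sE sN; case: entE => _ _ _ + _ => /(_ (index s E)).
rewrite nth_index // index_mem sE andbT; apply.
rewrite lt0n; apply: contra_neq sN => i0.
by rewrite -(nth_index (0, 0) sE) i0 nth0.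
Qed.

(* If the copy put [s.2 - s.1 + 2] consecutive entries into the block of [s], the
   sign of [s] and not being shadowed would force them onto a single level, which
   has only [s.2 - s.1 + 1] entries in that block. *)
Lemma right_overflow (s : segment) : s \in L -> s1.2 < s.1 ->
  (forall p, s.1.-1 <= p <= s.2 -> in_seg (col p) s) -> False.
Proof.
move=> sL s1s sB; have [a1 ab bk] := Lambda_seg sL.
have [a1' ab' bk'] := Lambda_seg (mem_E_Lambda head_mem_E).
have sk : is_segment k s by apply/and3P.
have lev_in := @block_level s sL.
have sB' p : in_seg p s -> in_seg (col p) s by rewrite /in_seg => ?; apply: sB; lia.
have sa : in_seg s.1 s by rewrite /in_seg; lia.
have x0s : in_seg (col s.1.-1) s by apply: sB; lia.
(* For a long part, not being shadowed orders the value at [s.1.-1] against the extremum farther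
   from it in the way that [level_pair] requires. For length one the sign was chosen for this
   purpose. *)
have lx0 : lev s.1.-1 = lev s.1.
  case: (ltnP 1 (seg_len s)) => len; last first.
    apply: (level_pair _ _ _ sL x0s (sB' _ sa)); try lia.
    by rewrite /part_sign ltnNge len s1s.
  have [ms _] := argminP pi sk; have [Ms _] := argmaxP pi sk.
  have nsh : ~ shadowed pi s1 s.
    by apply: E_not_shadowed; [exact: long_mem_E|apply/eqP => e; move: s1s; rewrite e; lia].
  have inK p : in_seg p s -> 1 <= p <= k by rewrite /in_seg; lia.
  have xk : 1 <= s.1.-1 <= k by lia.
  have xN p : in_seg p s -> pval pi s.1.-1 != pval pi p.
    move=> ps; apply/eqP => /(pval_inj xk (inK _ ps)) e.
    by move: ps; rewrite -e /in_seg; lia.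
  have dis : seg_disjoint s1 s by rewrite /seg_disjoint s1s.
  have := xN _ ms; have := xN _ Ms.
  have [mM _] := argmin_lt_argmax pi sk len.
  case: (ltngtP (argmin pi s) (argmax pi s)) mM => [lt|lt|//] _.
  - rewrite -(lev_in sB' (argmax pi s) s.1) // => xM _.
    apply: (level_pair _ _ _ sL x0s (sB' _ Ms)); try (by move: Ms; rewrite /in_seg; lia).
    rewrite /part_sign len lt; congr (~~ _); apply/esym.
    rewrite ltn_neqAle xM leqNgt; apply/negP => sh.
    by apply: nsh; split=> //; [exact: head_long|apply: Or41].
  - rewrite -(lev_in sB' (argmin pi s) s.1) // => _ xm.
    apply: (level_pair _ _ _ sL x0s (sB' _ ms)); try (by move: ms; rewrite /in_seg; lia).
    rewrite /part_sign len -!leqNgt ltnW //; apply/esym; rewrite leqNgt; apply/negP => sh.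
    by apply: nsh; split=> //; [exact: head_long|apply: Or42].
have gap p : s.1.-1 <= p < s.2 -> col p < col p.+1.
  apply: (level_incr sL) => //; first by lia.
  move=> q qs; case: (eqVneq q s.1.-1) => [-> //|qx].
  by rewrite lx0; apply: lev_in => //; rewrite /in_seg; lia.
have sb : in_seg s.2 s by rewrite /in_seg; lia.
have := @strict_incr_gap col s.1.-1 s.2 gap s.1.-1 s.2.
by have := sB' _ sb; move: x0s; rewrite /in_seg; lia.
Qed.

(** Mirror image of [right_overflow]: the extra position is [s.2.+1], and it is compared with the
    earlier of the two extrema of [s]. *)
Lemma left_overflow (s : segment) : s \in L -> s.2 < s1.1 ->
  (forall p, s.1 <= p <= s.2.+1 -> in_seg (col p) s) -> False.
Proof.
move=> sL s1s sB; have [a1 ab bk] := Lambda_seg sL.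
have [a1' ab' bk'] := Lambda_seg (mem_E_Lambda head_mem_E).
have sk : is_segment k s by apply/and3P.
have lev_in := @block_level s sL.
have sB' p : in_seg p s -> in_seg (col p) s by rewrite /in_seg => ?; apply: sB; lia.
have sa : in_seg s.1 s by rewrite /in_seg; lia.
have sb : in_seg s.2 s by rewrite /in_seg; lia.
have x0s : in_seg (col s.2.+1) s by apply: sB; lia.
have lx0 : lev s.2.+1 = lev s.1.
  case: (ltnP 1 (seg_len s)) => len; last first.
    have e12 : s.1 = s.2 by move: len; rewrite /seg_len; lia.
    apply/esym/(level_pair _ _ _ sL (sB' _ sa) x0s); try lia.
    rewrite /part_sign ltnNge len -e12 ifF //; apply/negbTE; lia.
  have [ms _] := argminP pi sk; have [Ms _] := argmaxP pi sk.
  have nsh : ~ shadowed pi s1 s.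
    by apply: E_not_shadowed; [exact: long_mem_E|apply/eqP => e; move: s1s; rewrite e; lia].
  have inK p : in_seg p s -> 1 <= p <= k by rewrite /in_seg; lia.
  have xk : 1 <= s.2.+1 <= k by lia.
  have xN p : in_seg p s -> pval pi p != pval pi s.2.+1.
    move=> ps; apply/eqP => /(pval_inj (inK _ ps) xk) e.
    by move: ps; rewrite e /in_seg; lia.
  have dis : seg_disjoint s1 s by rewrite /seg_disjoint s1s orbT.
  have := xN _ ms; have := xN _ Ms.
  have [mM _] := argmin_lt_argmax pi sk len.
  case: (ltngtP (argmin pi s) (argmax pi s)) mM => [lt|lt|//] _.
  - rewrite -(lev_in sB' (argmin pi s) s.1) // => _ xm.
    apply/esym/(level_pair _ _ _ sL (sB' _ ms) x0s); try (by move: ms; rewrite /in_seg; lia).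
    rewrite /part_sign len lt; congr (~~ _); apply/esym.
    rewrite ltn_neqAle xm leqNgt; apply/negP => sh.
    by apply: nsh; split=> //; [exact: head_long|apply: Or43].
  - rewrite -(lev_in sB' (argmax pi s) s.1) // => xM _.
    apply/esym/(level_pair _ _ _ sL (sB' _ Ms) x0s); try (by move: Ms; rewrite /in_seg; lia).
    rewrite /part_sign len -!leqNgt ltnW //; apply/esym; rewrite leqNgt; apply/negP => sh.
    by apply: nsh; split=> //; [exact: head_long|apply: Or44].
have gap p : s.1 <= p < s.2.+1 -> col p < col p.+1.
  apply: (level_incr sL) => //; first by lia.
  move=> q qs; case: (eqVneq q s.2.+1) => [-> //|qx].
  by apply: lev_in => //; rewrite /in_seg; lia.
have := @strict_incr_gap col s.1 s.2.+1 gap s.1 s.2.+1.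
by have := sB' _ sa; move: x0s; rewrite /in_seg; lia.
Qed.

(** Induction from [k] down to [s1.2]. The next part [s] starts at [p.+1] and satisfies the bound at
    [s.2]; if [col p] exceeded [p], the entries at [p], ..., [s.2] would all lie in the block of
    [s], against [right_overflow]. *)
Lemma right_prefix p : s1.2 <= p <= k -> (part L p).2 = p -> col p <= p.
Proof.
have [a1' ab' bk'] := Lambda_seg (mem_E_Lambda head_mem_E).
have [n] := ubnP (k - p); elim: n p => // n IH p kp pk pE.
have [pk'|] := ltnP p k; last by have := @col_bounds p; lia.
have [sL] : part L p.+1 \in L /\ in_seg p.+1 (part L p.+1) by apply: partP; lia.
set s := part L p.+1 in sL *; rewrite /in_seg => sp.
have [a1 ab bk] := Lambda_seg sL.
have sE : s.1 = p.+1.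
  case: (ltngtP s.1 p.+1) => // lt; last by lia.
  have ps : in_seg p s by rewrite /in_seg; lia.
  by move: pE; rewrite (part_eq Lpart sL ps); lia.
have sb : in_seg s.2 s by rewrite /in_seg; lia.
have colb : col s.2 <= s.2 by apply: IH; rewrite ?(part_eq Lpart sL sb) //; lia.
rewrite leqNgt; apply/negP => pc; apply: (right_overflow sL); first by lia.
by rewrite sE /=; apply: block_between => //; lia.
Qed.

(** Mirror image of [right_prefix], with the induction going from position 1 up to [s1.1]. *)
Lemma left_suffix p : 1 <= p <= s1.1 -> (part L p).1 = p -> p <= col p.
Proof.
have [a1' ab' bk'] := Lambda_seg (mem_E_Lambda head_mem_E).
have [n] := ubnP p; elim: n p => // n IH p kp pk pE.
have [pk'|] := ltnP 1 p; last by have := @col_bounds p; lia.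
have [sL] : part L p.-1 \in L /\ in_seg p.-1 (part L p.-1) by apply: partP; lia.
set s := part L p.-1 in sL *; rewrite /in_seg => sp.
have [a1 ab bk] := Lambda_seg sL.
have sE : s.2 = p.-1.
  case: (ltngtP s.2 p.-1) => // lt; first by lia.
  have ps : in_seg p s by rewrite /in_seg; lia.
  by move: pE; rewrite (part_eq Lpart sL ps); lia.
have sa : in_seg s.1 s by rewrite /in_seg; lia.
have cola : s.1 <= col s.1 by apply: IH; rewrite ?(part_eq Lpart sL sa) //; lia.
rewrite leqNgt; apply/negP => pc; apply: (left_overflow sL); first by lia.
have -> : s.2.+1 = p by lia.
by apply: block_between => //; lia.
Qed.

Lemma copy_exact_gt1 : exists m, forall p, 1 <= p <= k -> lev p = m /\ col p = p.
Proof.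
have s1E := head_mem_E; have s1L := mem_E_Lambda s1E.
have [a1 ab bk] := Lambda_seg s1L.
have [_ _ e1 _ e3] := entE.
have inK s p : s \in E -> in_seg p s -> 1 <= p <= k.
  by move=> /mem_E_Lambda/Lambda_seg[? ? ?]; rewrite /in_seg; lia.
(* Both [lev s.1] and [lev s.2] are recorded, because the end at which the level becomes known
   depends on the side of sigma_1. *)
have block (s : segment) : s \in E -> s.1 <= col s.1 -> col s.2 <= s.2 ->
    forall p, in_seg p s -> lev p = lev s.1 /\ lev p = lev s.2 /\ col p = p.
  move=> sE ca cb p ps; have sL := mem_E_Lambda sE; have [b1 bb bk'] := Lambda_seg sL.
  have sB q : in_seg q s -> in_seg (col q) s by apply: block_between.
  have sa : in_seg s.1 s by rewrite /in_seg; lia.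
  have sb : in_seg s.2 s by rewrite /in_seg; lia.
  have lvl := block_level sL sB.
  by split; [exact: lvl|split; [exact: lvl|exact: (block_exact sL sB)]].
have right_end (s : segment) : s \in E -> s1.2 <= s.2 -> col s.2 <= s.2.
  move=> sE s12; have sL := mem_E_Lambda sE; have [b1 bb bk'] := Lambda_seg sL.
  have sb : in_seg s.2 s by rewrite /in_seg; lia.
  by apply: right_prefix; rewrite ?(part_eq Lpart sL sb) //; lia.
have left_end (s : segment) : s \in E -> s.1 <= s1.1 -> s.1 <= col s.1.
  move=> sE s12; have sL := mem_E_Lambda sE; have [b1 bb bk'] := Lambda_seg sL.
  have sa : in_seg s.1 s by rewrite /in_seg; lia.
  by apply: left_suffix; rewrite ?(part_eq Lpart sL sa) //; lia.
pose m := lev s1.1; exists m.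
have between (F : seq segment) q : {subset F <= E} ->
    (forall s p, s \in F -> in_seg p s -> lev p = m /\ col p = p) ->
    forall s t, s \in F -> t \in F -> 1 <= q <= k ->
    seg_min pi s <= pval pi q <= seg_max pi t -> lev q = m /\ col q = q.
  move=> FE Fx s t sF tF qk.
  have sk := allP Ek _ (FE _ sF); have tk := allP Ek _ (FE _ tF).
  have [ms <-] := argminP pi sk; have [Mt <-] := argmaxP pi tk.
  have [? ?] := Fx _ _ sF ms; have [? ?] := Fx _ _ tF Mt.
  by apply: value_exact => //; [exact: inK (FE _ sF) ms|exact: inK (FE _ tF) Mt].
(* Induction along the entangling. For sigma_1 both end bounds come from [left_end] and [right_end];
   for later segments only the far end does, and the near end is exact by [between]. *)
have exactE n : n <= size E ->
    forall s p, s \in take n E -> in_seg p s -> lev p = m /\ col p = p.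
  elim: n => [|n IH] nE s p; first by rewrite take0.
  rewrite (take_nth (0, 0)) // mem_rcons inE => /orP[/eqP ->|sE]; last exact: IH (ltnW nE) _ _ sE.
  case: n IH nE => [|n] IH nE.
    rewrite nth0 => ps; have [] := block _ s1E _ _ p ps; first exact: left_end.
      exact: right_end.
    by move=> -> [].
  set t := nth _ _ _; set F := take n.+1 E.
  have tE : t \in E by exact: mem_nth.
  have [b1 bb bk'] := Lambda_seg (mem_E_Lambda tE).
  have FE : {subset F <= E} by move=> z; apply: mem_take.
  have F0 : F != [::] by rewrite /F; case: (E) E_neq0.
  have IHF := IH (ltnW nE).
  have [smin minF minE] := fam_min_mem pi F0; have [smax maxF maxE] := fam_max_mem pi F0.
  have ta : 1 <= t.1 <= k by lia.
  have tb : 1 <= t.2 <= k by lia.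
  have := e1 n.+1 nE; rewrite /= -/t -/F minE maxE.
  move=> [[s1t /andP[lo hi]]|[ts1 /andP[lo hi]]] pt.
    have [|lt ct] := between F t.1 FE IHF smin smax minF maxF ta; first by lia.
    have [] := block _ tE _ _ p pt; first by rewrite ct.
      by apply: right_end => //; lia.
    by rewrite lt => -> [].
  have [|lt ct] := between F t.2 FE IHF smin smax minF maxF tb; first by lia.
  have [] := block _ tE _ _ p pt; first by apply: left_end => //; lia.
    by rewrite ct.
  by rewrite lt => _ [].
(* Every value lies in the range of some segment of [E], and the copy is already exact on that
   segment. *)
move=> q qk; have [s sE sq] := e3 _ (pval_bounds pi qk).
apply: (between E q _ _ s s) => // t p tE.
by apply: (exactE (size E)); rewrite ?take_size.
Qed.

End CopyCoordinates.

(** * Block, level and column of an index of f_P *)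

Section Coordinates.
Variables (k : nat) (L : seq segment) (sg : segment -> bool).
Hypothesis Lpart : is_partition k L.
Hypothesis Lcover :
  forall p, 1 <= p <= k -> exists2 s : segment, s \in L & in_seg p s.

(** These coordinates repeat the decomposition of [x] inside [fP]: [xrow] is the quotient m, [xcol]
    is the position r + j in [pi], and [xlev] is the integer part of the value for [x] in [k^2].
    Indices start at 1 and offsets at 0, hence [x.-1]. *)
Definition xpart (x : nat) : segment := part L (x.-1 %/ k).+1.

Definition xoffset (x : nat) : nat := x.-1 - (xpart x).1.-1 * k.

Definition xrow (x : nat) : nat := xoffset x %/ seg_len (xpart x).

Definition xlev (x : nat) : nat :=
  if sg (xpart x) then xrow x else k - 1 - xrow x.

Definition xcol (x : nat) : nat :=
  (xpart x).1.-1 + (xoffset x %% seg_len (xpart x)).+1.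

Lemma partition_seg (s : segment) : s \in L -> [/\ 1 <= s.1, s.1 <= s.2 & s.2 <= k].
Proof.
move=> sL; have := sL; rewrite -index_mem => /(is_partition_nth Lpart).
by rewrite nth_index // => -[-> ? ?].
Qed.

Variables (x : nat) (xk : 1 <= x <= k ^ 2).

Lemma size_gt0 : 0 < k.
Proof. by case: k xk => // /andP[]; case: x. Qed.

Lemma cell_bounds : 1 <= (x.-1 %/ k).+1 <= k.
Proof.
rewrite /= ltn_divLR ?size_gt0 // mulnn.
by case/andP: xk => x1 xk2; rewrite prednK.
Qed.

Lemma xpartP : xpart x \in L /\ in_seg (x.-1 %/ k).+1 (xpart x).
Proof.
by have [s sL ps] := Lcover cell_bounds; rewrite /xpart (part_eq Lpart sL ps).
Qed.

Lemma xoffset_lt : xoffset x < seg_len (xpart x) * k.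
Proof.
have [sL] := xpartP; have [a1 ab bk] := partition_seg sL.
rewrite /in_seg => /andP[_]; rewrite ltn_divLR ?size_gt0 // => xs.
rewrite /xoffset; have -> : seg_len (xpart x) = (xpart x).2 - (xpart x).1.-1.
  by rewrite /seg_len; lia.
rewrite mulnBl; have : (xpart x).1.-1 * k < (xpart x).2 * k.
  by rewrite ltn_mul2r size_gt0; lia.
by lia.
Qed.

Lemma xoffsetE : x = ((xpart x).1.-1 * k + xoffset x).+1.
Proof.
have [sL] := xpartP; have [a1 ab bk] := partition_seg sL.
rewrite /in_seg => /andP[sx _].
have : (xpart x).1.-1 * k <= x.-1 by rewrite -leq_divRL ?size_gt0 //; lia.
by rewrite /xoffset; move: xk; lia.
Qed.

Lemma xpart_len : 0 < seg_len (xpart x).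
Proof.
have [sL _] := xpartP; have [a1 ab bk] := partition_seg sL.
by rewrite /seg_len; lia.
Qed.

Lemma xrow_lt : xrow x < k.
Proof. by rewrite ltn_divLR ?xpart_len // mulnC xoffset_lt. Qed.

Lemma xlev_lt : xlev x < k.
Proof. by have := xrow_lt; rewrite /xlev; case: ifP; lia. Qed.

Lemma xcol_in : in_seg (xcol x) (xpart x).
Proof.
have [sL _] := xpartP; have [a1 ab bk] := partition_seg sL.
have := ltn_pmod (xoffset x) xpart_len.
by rewrite /in_seg /xcol /seg_len; lia.
Qed.

Lemma xcol_bounds : 1 <= xcol x <= k.
Proof.
have [sL _] := xpartP; have [a1 ab bk] := partition_seg sL.
by have := xcol_in; rewrite /in_seg; lia.
Qed.

Lemma part_xcol : part L (xcol x) = xpart x.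
Proof. by have [sL _] := xpartP; apply: part_eq Lpart sL xcol_in. Qed.

End Coordinates.

Section CoordinatesOrder.
Variables (k : nat) (L : seq segment) (sg : segment -> bool).
Hypothesis Lpart : is_partition k L.
Hypothesis Lcover :
  forall p, 1 <= p <= k -> exists2 s : segment, s \in L & in_seg p s.
Local Notation xpart := (xpart k L).
Local Notation xcol := (xcol k L).
Local Notation xlev := (xlev k L sg).
Variables (x y : nat) (xk : 1 <= x <= k ^ 2) (yk : 1 <= y <= k ^ 2).

(** Otherwise the left end of [xpart x] would lie in [xpart y], so the two parts would coincide.
    This supplies [col_block]. *)
Lemma xpart_le_xcol : x <= y -> (xpart x).1 <= xcol y.
Proof.
move=> xy; have [sL sx] := xpartP Lpart Lcover xk.
have [tL ty] := xpartP Lpart Lcover yk.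
have le : x.-1 %/ k <= y.-1 %/ k by apply: leq_div2r; lia.
have cy := xcol_in Lpart Lcover yk.
rewrite leqNgt; apply/negP => lt.
have [a1 ab bk] := partition_seg Lpart sL.
have st : in_seg (xpart x).1 (xpart y).
  by move: sx ty cy lt le; rewrite /in_seg; lia.
have ss : in_seg (xpart x).1 (xpart x) by rewrite /in_seg; lia.
have e := part_eq Lpart tL st; rewrite (part_eq Lpart sL ss) in e.
by move: lt cy; rewrite e /in_seg; lia.
Qed.

Hypotheses (xy : x < y) (exy : xpart x = xpart y).

Lemma xoffset_ltn : xoffset k L x < xoffset k L y.
Proof.
have := xoffsetE Lpart Lcover xk; have := xoffsetE Lpart Lcover yk.
by rewrite -exy; move: (_ * k) xy => a; lia.
Qed.

Lemma xlev_mono : if sg (xpart x) then xlev x <= xlev y else xlev y <= xlev x.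
Proof.
have : xrow k L x <= xrow k L y.
  by rewrite /xrow -exy; apply/leq_div2r/ltnW/xoffset_ltn.
by rewrite /xlev -exy; case: (sg _) => H; lia.
Qed.

Lemma xcol_incr : xlev x = xlev y -> xcol x < xcol y.
Proof.
(* For the sign [-], equal levels give equal rows only because both rows are below [k], so that the
   subtraction is not truncated. *)
have rx := xrow_lt Lpart Lcover xk; have ry := xrow_lt Lpart Lcover yk.
move=> lxy; have rxy : xrow k L x = xrow k L y.
  by move: lxy; rewrite /xlev -exy; case: (sg _); lia.
have := xoffset_ltn.
rewrite (divn_eq (xoffset k L x) (seg_len (xpart x))).
rewrite (divn_eq (xoffset k L y) (seg_len (xpart y))).
by rewrite -!/(xrow _ _ _) rxy /xcol -exy; lia.
Qed.

End CoordinatesOrder.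

(** * Comparing values of f_P through levels and columns *)

Section FunctionValues.
Variables (R : realType) (k : nat) (pi : 'S_k) (L : seq segment).
Variable sg : segment -> bool.
Hypothesis Lpart : is_partition k L.
Hypothesis Lcover :
  forall p, 1 <= p <= k -> exists2 s : segment, s \in L & in_seg p s.
Local Notation xcol := (xcol k L).
Local Notation xlev := (xlev k L sg).
Local Notation f := (fP pi R L (map sg L)).

(** Writing the value over the denominator [2 * k] turns comparisons of reals into comparisons of
    naturals. *)
Lemma fP_coord x : 1 <= x <= k ^ 2 ->
  f x = ((xlev x * (2 * k) + pval pi (xcol x))%N%:R / (2 * k)%N%:R)%R.
Proof.
move=> xk; have k0 := size_gt0 xk.
have [s sL xs] := Lcover (cell_bounds xk).
have fL : find (in_seg (x.-1 %/ k).+1) L < size L by rewrite -has_find; apply/hasP; exists s.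
have k2 : ((2 * k)%:R != 0 :> R)%R by rewrite pnatr_eq0; lia.
by rewrite /fP (nth_map (0, 0)) // [in RHS]natrD mulrDl (natrM _ (xlev x)) mulfK.
Qed.

Lemma fP_ltE x y : 1 <= x <= k ^ 2 -> 1 <= y <= k ^ 2 ->
  (f x < f y)%R =
  (xlev x * (2 * k) + pval pi (xcol x) < xlev y * (2 * k) + pval pi (xcol y)).
Proof.
move=> xk yk; have k0 := size_gt0 xk.
by rewrite !fP_coord // ltr_pM2r ?ltr_nat // invr_gt0 ltr0n; lia.
Qed.

(** The column contributes at most [k], less than the [2 * k] of one level, so values compare
    lexicographically. This supplies [lev_order]. *)
Lemma fP_lt x y : 1 <= x <= k ^ 2 -> 1 <= y <= k ^ 2 -> (f x < f y)%R ->
  xlev x <= xlev y /\ (xlev x = xlev y -> pval pi (xcol x) < pval pi (xcol y)).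
Proof.
move=> xk yk; rewrite fP_ltE // => lt; split; last by move=> e; move: lt; rewrite e ltn_add2l.
have := pval_bounds pi (xcol_bounds Lpart Lcover yk).
move=> yb; rewrite leqNgt; apply/negP => lt'.
have : (xlev y).+1 * (2 * k) <= xlev x * (2 * k) by rewrite leq_mul2r lt' orbT.
by rewrite mulSn; lia.
Qed.

Lemma fP_level x m : 1 <= x <= k ^ 2 ->
  (m%:R < f x < m.+1%:R)%R = (xlev x == m).
Proof.
move=> xk; have k0 := size_gt0 xk.
have k2 : (0 < (2 * k)%N%:R :> R)%R by rewrite ltr0n; lia.
rewrite fP_coord // ltr_pdivlMr // ltr_pdivrMr // -!natrM !ltr_nat.
have := pval_bounds pi (xcol_bounds Lpart Lcover xk).
case: (ltngtP (xlev x) m) => [lt|lt|->] vb.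
- have : (xlev x).+1 * (2 * k) <= m * (2 * k) by rewrite leq_mul2r lt orbT.
  by rewrite mulSn; lia.
- have : m.+1 * (2 * k) <= xlev x * (2 * k) by rewrite leq_mul2r lt orbT.
  by lia.
- by rewrite mulSn; lia.
Qed.

End FunctionValues.

(** * From exact coordinates to uniqueness, and the inequality between [d] and [u] *)

Lemma entangling_unique (R : realType) k (pi : 'S_k) E : 0 < k -> entangling pi E ->
  unique pi R (Lambda k E) (map (part_sign pi (head (0, 0) E)) (Lambda k E)).
Proof.
move=> k0 entE c [sc cinc call cord].
set sg := part_sign _ _; set L := Lambda k E in cord *.
have [Ek Ed _ _ _] := entE.
have Lpart : is_partition k L by exact: Lambda_partition.
have Lcover := @Lambda_cover k E; rewrite -/L in Lcover.
pose C p := nth 0 c p.-1.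
pose lev p := xlev k L sg (C p); pose col p := xcol k L (C p).
have Ck p : 1 <= p <= k -> 1 <= C p <= k ^ 2.
  by move=> pk; apply: (allP call); apply: mem_nth; rewrite sc; lia.
have Clt p q : 1 <= p -> p < q -> q <= k -> C p < C q.
  move=> p1 pq qk; apply: (sorted_ltn_nth ltn_trans) => //; rewrite ?inE ?sc; lia.
have colb p : 1 <= p <= k -> 1 <= col p <= k by move=> /Ck; apply: xcol_bounds.
have pcol p : 1 <= p <= k -> part L (col p) = xpart k L (C p).
  by move=> /Ck; apply: part_xcol.
have [m mE] : exists m, forall p, 1 <= p <= k -> lev p = m /\ col p = p.
  (* With [k = 1] there is a single position, so its own level and column will do. *)
  have [k1|k1] := ltnP 1 k; last first.
    exists (lev 1) => p pk; have -> : p = 1 by lia.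
    by split=> //; have := @colb 1; lia.
  have rng p q : 1 <= p -> p < q -> q <= k -> 1 <= p <= k /\ 1 <= q <= k by lia.
  apply: (copy_exact_gt1 entE) => //.
  - move=> p q p1 pq qk; have [pk qk'] := rng p q p1 pq qk; rewrite pcol //.
    exact: (xpart_le_xcol Lpart Lcover (Ck _ pk) (Ck _ qk') (ltnW (Clt _ _ p1 pq qk))).
  - move=> p q p1 pq qk; have [pk qk'] := rng p q p1 pq qk; rewrite !pcol //.
    exact: (xlev_mono sg Lpart Lcover (Ck _ pk) (Ck _ qk') (Clt _ _ p1 pq qk)).
  - move=> p q p1 pq qk; have [pk qk'] := rng p q p1 pq qk; rewrite !pcol //.
    exact: (xcol_incr (sg := sg) Lpart Lcover (Ck _ pk) (Ck _ qk') (Clt _ _ p1 pq qk)).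
  - move=> p q pk qk; rewrite -cord // => lt.
    exact: (fP_lt Lpart Lcover (Ck _ pk) (Ck _ qk) lt).
exists m.
  by have [<- _] := mE 1 k0; apply: xlev_lt => //; apply: Ck.
move=> x; apply/idP/andP => [xc|[xk]].
  have xk := allP call _ xc; split=> //.
  have ix : index x c < k by rewrite -sc index_mem.
  rewrite fP_level //; have [|<- _] := mE (index x c).+1; first by lia.
  by rewrite /lev /C /= nth_index.
(* An entry [x] of level [m] shares its block, level and column with the copy entry at position
   [xcol k L x]. As columns strictly increase along a level of a block, the two indices agree. *)
rewrite fP_level // => /eqP xm.
have colk := xcol_bounds Lpart Lcover xk; set p := xcol k L x in colk.
have [lp cp] := mE p colk; have Cpk := Ck _ colk.
have ep : xpart k L x = xpart k L (C p).
  by rewrite -pcol // cp /p part_xcol.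
have -> : x = C p.
  case: (ltngtP x (C p)) => // lt.
    by have := xcol_incr Lpart Lcover xk Cpk lt ep (etrans xm (esym lp)); rewrite -/(col p) cp ltnn.
  by have := xcol_incr Lpart Lcover Cpk xk lt (esym ep) (etrans lp (esym xm)); rewrite -/(col p) cp ltnn.
by apply: mem_nth; rewrite sc; lia.
Qed.

Lemma entangling_signed k (pi : 'S_k) E : entangling pi E ->
  signed_partition pi (Lambda k E) (map (part_sign pi (head (0, 0) E)) (Lambda k E)).
Proof.
case=> Ek Ed _ _ _; split; rewrite ?size_map //; first exact: Lambda_partition.
by move=> i iL /= len; rewrite (nth_map (0, 0)) // /part_sign len.
Qed.

Theorem theorem3p8 (R : realType) (k : nat) (k_gt0 : 0 < k) (pi : 'S_k) :
  (forall E : seq segment, entangling pi E ->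
    exists S : (size (Lambda k E)).-tuple bool,
      signed_partition pi (Lambda k E) S /\ unique pi R (Lambda k E) S) /\
  d pi <= u pi R.
Proof.
split=> [E entE|].
  exists [tuple of map (part_sign pi (head (0, 0) E)) (in_tuple (Lambda k E))].
  by split; [exact: entangling_signed|exact: entangling_unique].
apply/bigmax_leqP => n /asboolP[E entE dEn].
apply: (@leq_bigmax_cond _ _ (fun i : 'I_k.+1 => i : nat)); apply/asboolP.
exists (Lambda k E), (map (part_sign pi (head (0, 0) E)) (Lambda k E)).
by split; [exact: entangling_signed|exact: entangling_unique|].
Qed.
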